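(* Let $(\mathfrak g,[\cdot,\cdot,\cdot],\alpha,\beta)$ be a 3-Bihom-Lie superalgebra over a field $\mathbb K$ and $(M,\rho,\alpha_M,\beta_M)$ a representation of $\mathfrak g$. Assume that the maps $\alpha$ and $\beta_M$ are surjective. If $\theta:\mathfrak g\times\mathfrak g\times\mathfrak g\to M$ is a 3-cocycle associated with $\rho$, then $(\mathfrak g\oplus M,[\cdot,\cdot,\cdot]_\theta,\alpha+\alpha_M,\beta+\beta_M)$ is a 3-Bihom-Lie superalgebra, where $\alpha+\alpha_M,\ \beta+\beta_M:\mathfrak g\oplus M\to\mathfrak g\oplus M$ are defined by $(\alpha+\alpha_M)(u+x)=\alpha(u)+\alpha_M(x)$ and $(\beta+\beta_M)(u+x)=\beta(u)+\beta_M(x)$, and the bracket $[\cdot,\cdot,\cdot]_\theta$ is defined by $$[u+x,v+y,w+z]_\theta=[u,v,w]+\theta(u,v,w)+\rho(u,v)(z)-(-1)^{|v||w|}\rho(u,\alpha^{-1}\beta(w))(\alpha_M\beta_M^{-1}(y))+(-1)^{|u|(|v|+|w|)}\rho(v,\alpha^{-1}\beta(w))(\alpha_M\beta_M^{-1}(x))$$ for all $u,v,w\in\mathfrak g$ and $x,y,z\in M$. (It is called the $T_\theta$-extension of $(\mathfrak g,[\cdot,\cdot,\cdot],\alpha,\beta)$ by $M$ and denoted $T_\theta(\mathfrak g)$.)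
   Context: For a homogeneous element $x$, $|x|\in\mathbb Z_2$ denotes its degree; identities involving $|x|$ are for homogeneous elements. $\mathfrak g\oplus M$ is the direct sum of $\mathbb Z_2$-graded spaces, and the bracket formula is for homogeneous $u+x,v+y,w+z$. A 3-Bihom-Lie superalgebra over $\mathbb K$ is a quadruple $(\mathfrak g,[\cdot,\cdot,\cdot],\alpha,\beta)$ consisting of a $\mathbb Z_2$-graded vector space $\mathfrak g=\mathfrak g_0\oplus\mathfrak g_1$, an even trilinear map $[\cdot,\cdot,\cdot]:\mathfrak g\otimes\mathfrak g\otimes\mathfrak g\to\mathfrak g$ and two even endomorphisms $\alpha,\beta:\mathfrak g\to\mathfrak g$ such that for all $x,y,z,u,v\in\mathfrak g$: (1) $\alpha\circ\beta=\beta\circ\alpha$; (2) $\alpha([x,y,z])=[\alpha(x),\alpha(y),\alpha(z)]$ and $\beta([x,y,z])=[\beta(x),\beta(y),\beta(z)]$; (3) $[\beta(x),\beta(y),\alpha(z)]=-(-1)^{|x||y|}[\beta(y),\beta(x),\alpha(z)]=-(-1)^{|y||z|}[\beta(x),\beta(z),\alpha(y)]$; (4) $[\beta^2(x),\beta^2(y),[\beta(z),\beta(u),\alpha(v)]]=(-1)^{(|u|+|v|)(|x|+|y|+|z|)}[\beta^2(u),\beta^2(v),[\beta(x),\beta(y),\alpha(z)]]-(-1)^{(|z|+|v|)(|x|+|y|)+|u||v|}[\beta^2(z),\beta^2(v),[\beta(x),\beta(y),\alpha(u)]]+(-1)^{(|z|+|u|)(|x|+|y|)}[\beta^2(z),\beta^2(u),[\beta(x),\beta(y),\alpha(v)]]$.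 A representation of $\mathfrak g$ is a 4-tuple $(M,\rho,\alpha_M,\beta_M)$ where $M$ is a vector superspace, $\alpha_M,\beta_M\in\mathrm{End}(M)$ are two commuting linear maps and $\rho:\mathfrak g\times\mathfrak g\to\mathrm{End}(M)$ is a super-skewsymmetric bilinear map ($\rho(u,v)=-(-1)^{|u||v|}\rho(v,u)$) such that for all $u,v,x,y\in\mathfrak g$: (R1) $\rho(\alpha(u),\alpha(v))\circ\alpha_M=\alpha_M\circ\rho(u,v)$; (R2) $\rho(\beta(u),\beta(v))\circ\beta_M=\beta_M\circ\rho(u,v)$; (R3) $\rho(\alpha\beta(u),\alpha\beta(v))\circ\rho(x,y)=(-1)^{(|u|+|v|)(|x|+|y|)}\rho(\beta(x),\beta(y))\circ\rho(\alpha(u),\alpha(v))+\rho([\beta(u),\beta(v),x],\beta(y))\circ\beta_M+(-1)^{|x|(|u|+|v|)}\rho(\beta(x),[\beta(u),\beta(v),y])\circ\beta_M$; (R4) $\rho([\beta(u),\beta(v),x],\beta(y))\circ\beta_M=(-1)^{|u|(|x|+|v|)}\rho(\alpha\beta(v),\beta(x))\circ\rho(\alpha(u),y)+(-1)^{|x|(|u|+|v|)}\rho(\beta(x),\alpha\beta(u))\circ\rho(\alpha(v),y)+\rho(\alpha\beta(u),\alpha\beta(v))\circ\rho(x,y)$. A 3-cocycle associated with $\rho$ is a 3-linear map $\theta:\mathfrak g\times\mathfrak g\times\mathfrak g\to M$ such that for all $x_1,\dots,x_5\in\mathfrak g$: (C1) $\alpha_M\theta(x_1,x_2,x_3)=\theta(\alpha(x_1),\alpha(x_2),\alpha(x_3))$;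 (C2) $\beta_M\theta(x_1,x_2,x_3)=\theta(\beta(x_1),\beta(x_2),\beta(x_3))$; (C3) $\theta(\beta(x_1),\beta(x_2),\alpha(x_3))=-(-1)^{|x_1||x_2|}\theta(\beta(x_2),\beta(x_1),\alpha(x_3))=-(-1)^{|x_2||x_3|}\theta(\beta(x_1),\beta(x_3),\alpha(x_2))$; (C4) writing $\Theta(a,b;c,d,e)=\theta(\beta^2(a),\beta^2(b),[\beta(c),\beta(d),\alpha(e)])+\rho(\beta^2(a),\beta^2(b))\theta(\beta(c),\beta(d),\alpha(e))$, $\Theta(x_1,x_2;x_3,x_4,x_5)=(-1)^{(|x_4|+|x_5|)(|x_1|+|x_2|+|x_3|)}\Theta(x_4,x_5;x_1,x_2,x_3)-(-1)^{(|x_3|+|x_5|)(|x_1|+|x_2|)+|x_4||x_5|}\Theta(x_3,x_5;x_1,x_2,x_4)+(-1)^{(|x_3|+|x_4|)(|x_1|+|x_2|)}\Theta(x_3,x_4;x_1,x_2,x_5)$.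
   Formalization: As α and β_M are only surjective, α⁻¹β(w) and β_M⁻¹(y) are read as preimages, and ρ(u,α⁻¹β(w))(α_Mβ_M⁻¹(y)) is assumed independent of their choice (automatic if α, β_M are bijective); α_M, β_M, ρ and θ are assumed even. *)

(* Defs.v *)
From HB Require Import structures.
From mathcomp Require Import all_boot all_order all_algebra.
From mathcomp Require Import boolp.

Set Implicit Arguments.
Unset Strict Implicit.
Unset Printing Implicit Defensive.

Import GRing.Theory.
Local Open Scope ring_scope.

(* A grading V = V_0 (+) V_1 is given by its two projections: [component i v]
   is the component of [v] in V_i, so that V_i = { v | component i v = v }. *)
Record superspace (K : fieldType) := Superspace {
  superspace_sort :> lmodType K;
  component : 'Z_2 -> superspace_sort -> superspace_sort;
  component_linear : forall i, linear (component i);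
  component_component : forall i j v, component i (component j v) =
    if i == j then component j v else 0;
  component_sum : forall v, v = component 0 v + component 1 v
}.

Definition homog (K : fieldType) (V : superspace K) (i : 'Z_2) (v : V) : Prop :=
  component i v = v.

Definition sgn (K : fieldType) (e : 'Z_2) : K := (-1) ^+ e.

Section Maps.
Variable K : fieldType.
Implicit Types U V W X : superspace K.

Definition even1 U V (f : U -> V) : Prop :=
  forall i u, homog i u -> homog i (f u).

Definition even3 U V W X (f : U -> V -> W -> X) : Prop :=
  forall i j k u v w, homog i u -> homog j v -> homog k w ->
    homog (i + j + k) (f u v w).

Definition trilinear U V W X (f : U -> V -> W -> X) : Prop :=
  [/\ forall v w, linear (fun u => f u v w),
      forall u w, linear (fun v => f u v w) &
      forall u v, linear (fun w => f u v w)].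

Definition surjective U V (f : U -> V) : Prop := forall v, exists u, f u = v.

Definition preimage U V (f : U -> V) (hf : surjective f) (v : V) : U :=
  projT1 (cid (hf v)).

End Maps.

Section DirectSum.
Variables (K : fieldType) (V W : superspace K).

Definition dsum_component (i : 'Z_2) (p : V * W) : V * W := (component i p.1, component i p.2).

Lemma dsum_component_linear i : linear (dsum_component i).
Proof.
by move=> a [x y] [x' y']; rewrite /dsum_component /= !component_linear.
Qed.

Lemma dsum_component_comp i j p :
  dsum_component i (dsum_component j p) = if i == j then dsum_component j p else 0.
Proof. by rewrite /dsum_component /= !component_component; case: eqP. Qed.

Lemma dsum_component_sum p : p = dsum_component 0 p + dsum_component 1 p.
Proof.
by case: p => x y; congr pair; rewrite /= -component_sum.
Qed.

Definition dsum : superspace K :=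
  @Superspace K (V * W)%type dsum_component dsum_component_linear dsum_component_comp
    dsum_component_sum.

Definition dsum_map (f : V -> V) (h : W -> W) (p : dsum) : dsum :=
  (f p.1, h p.2).

End DirectSum.

Section BihomLie.
Variables (K : fieldType) (g : superspace K).
Variables (br : g -> g -> g -> g) (alpha beta : g -> g).
Local Notation "'[' x , y , z ']'" := (br x y z)
  (x at level 200, y at level 200, z at level 200).
Local Notation sgn := (sgn K).

Record is_3BihomLie_superalgebra : Prop := {
  bracket_trilinear : trilinear br;
  bracket_even : even3 br;
  alpha_linear : linear alpha;
  alpha_even : even1 alpha;
  beta_linear : linear beta;
  beta_even : even1 beta;
  alpha_beta_comm : forall x, alpha (beta x) = beta (alpha x);
  alpha_bracket : forall x y z,
    alpha [x, y, z] = [alpha x, alpha y, alpha z];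
  beta_bracket : forall x y z,
    beta [x, y, z] = [beta x, beta y, beta z];
  bracket_skew12 : forall dx dy dz x y z,
    homog dx x -> homog dy y -> homog dz z ->
    [beta x, beta y, alpha z] = - sgn (dx * dy) *: [beta y, beta x, alpha z];
  bracket_skew23 : forall dx dy dz x y z,
    homog dx x -> homog dy y -> homog dz z ->
    [beta x, beta y, alpha z] = - sgn (dy * dz) *: [beta x, beta z, alpha y];
  bracket_jacobi : forall dx dy dz du dv x y z u v,
    homog dx x -> homog dy y -> homog dz z -> homog du u -> homog dv v ->
    [beta (beta x), beta (beta y), [beta z, beta u, alpha v]] =
      sgn ((du + dv) * (dx + dy + dz)) *:
        [beta (beta u), beta (beta v), [beta x, beta y, alpha z]]
    - sgn ((dz + dv) * (dx + dy) + du * dv) *: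
        [beta (beta z), beta (beta v), [beta x, beta y, alpha u]]
    + sgn ((dz + du) * (dx + dy)) *:
        [beta (beta z), beta (beta u), [beta x, beta y, alpha v]]
}.

Variables (M : superspace K) (rho : g -> g -> M -> M) (alphaM betaM : M -> M).

Record is_representation : Prop := {
  alphaM_linear : linear alphaM;
  alphaM_even : even1 alphaM;
  betaM_linear : linear betaM;
  betaM_even : even1 betaM;
  alphaM_betaM_comm : forall m, alphaM (betaM m) = betaM (alphaM m);
  rho_trilinear : trilinear rho;
  rho_even : even3 rho;
  rho_skew : forall du dv u v m, homog du u -> homog dv v ->
    rho u v m = - sgn (du * dv) *: rho v u m;
  rho_alpha : forall u v m,
    rho (alpha u) (alpha v) (alphaM m) = alphaM (rho u v m);
  rho_beta : forall u v m,
    rho (beta u) (beta v) (betaM m) = betaM (rho u v m);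
  rho_R3 : forall du dv dx dy u v x y m,
    homog du u -> homog dv v -> homog dx x -> homog dy y ->
    rho (alpha (beta u)) (alpha (beta v)) (rho x y m) =
      sgn ((du + dv) * (dx + dy)) *:
        rho (beta x) (beta y) (rho (alpha u) (alpha v) m)
    + rho [beta u, beta v, x] (beta y) (betaM m)
    + sgn (dx * (du + dv)) *: rho (beta x) [beta u, beta v, y] (betaM m);
  rho_R4 : forall du dv dx dy u v x y m,
    homog du u -> homog dv v -> homog dx x -> homog dy y ->
    rho [beta u, beta v, x] (beta y) (betaM m) =
      sgn (du * (dx + dv)) *:
        rho (alpha (beta v)) (beta x) (rho (alpha u) y m)
    + sgn (dx * (du + dv)) *:
        rho (beta x) (alpha (beta u)) (rho (alpha v) y m)
    + rho (alpha (beta u)) (alpha (beta v)) (rho x y m)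
}.

Variable theta : g -> g -> g -> M.

Definition cocycle_term (a b c d e : g) : M :=
  theta (beta (beta a)) (beta (beta b)) [beta c, beta d, alpha e]
  + rho (beta (beta a)) (beta (beta b)) (theta (beta c) (beta d) (alpha e)).

Record is_3cocycle : Prop := {
  theta_trilinear : trilinear theta;
  theta_even : even3 theta;
  theta_alpha : forall x1 x2 x3,
    alphaM (theta x1 x2 x3) = theta (alpha x1) (alpha x2) (alpha x3);
  theta_beta : forall x1 x2 x3,
    betaM (theta x1 x2 x3) = theta (beta x1) (beta x2) (beta x3);
  theta_skew12 : forall d1 d2 d3 x1 x2 x3,
    homog d1 x1 -> homog d2 x2 -> homog d3 x3 ->
    theta (beta x1) (beta x2) (alpha x3) =
      - sgn (d1 * d2) *: theta (beta x2) (beta x1) (alpha x3);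
  theta_skew23 : forall d1 d2 d3 x1 x2 x3,
    homog d1 x1 -> homog d2 x2 -> homog d3 x3 ->
    theta (beta x1) (beta x2) (alpha x3) =
      - sgn (d2 * d3) *: theta (beta x1) (beta x3) (alpha x2);
  theta_cocycle : forall d1 d2 d3 d4 d5 x1 x2 x3 x4 x5,
    homog d1 x1 -> homog d2 x2 -> homog d3 x3 -> homog d4 x4 -> homog d5 x5 ->
    cocycle_term x1 x2 x3 x4 x5 =
      sgn ((d4 + d5) * (d1 + d2 + d3)) *: cocycle_term x4 x5 x1 x2 x3
    - sgn ((d3 + d5) * (d1 + d2) + d4 * d5) *: cocycle_term x3 x5 x1 x2 x4
    + sgn ((d3 + d4) * (d1 + d2)) *: cocycle_term x3 x4 x1 x2 x5
}.

(* Surjectivity alone does not make alpha^-1 and betaM^-1 meaningful. This says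
   that rho(u, alpha^-1 beta(w)) (alphaM betaM^-1 (y)) does not depend on the
   preimages chosen; it is automatic when alpha and betaM are bijective, see
   [inverses_well_defined_inj]. *)
Definition inverses_well_defined : Prop :=
  forall u w a a' m m', alpha a = beta w -> alpha a' = beta w ->
    betaM m = betaM m' -> rho u a (alphaM m) = rho u a' (alphaM m').

Lemma inverses_well_defined_inj :
  injective alpha -> injective betaM -> inverses_well_defined.
Proof.
move=> inja injb u w a a' m m' ea ea' /injb->.
by have/inja-> : alpha a = alpha a' by rewrite ea ea'.
Qed.

Hypotheses (halpha : surjective alpha) (hbetaM : surjective betaM).
Local Notation alphaV := (preimage halpha).
Local Notation betaMV := (preimage hbetaM).

Definition Ttheta_homog (du dv dw : 'Z_2) (p q r : dsum g M) : dsum g M :=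
  let: (u, x) := p in let: (v, y) := q in let: (w, z) := r in
  ([u, v, w],
   theta u v w + rho u v z
   - sgn (dv * dw) *: rho u (alphaV (beta w)) (alphaM (betaMV y))
   + sgn (du * (dv + dw)) *: rho v (alphaV (beta w)) (alphaM (betaMV x))).

(* The formula for homogeneous elements, extended additively to all elements;
   [Ttheta_bracketE] checks that it is the given one on homogeneous elements. *)
Definition Ttheta_bracket (p q r : dsum g M) : dsum g M :=
  \sum_(i : 'Z_2) \sum_(j : 'Z_2) \sum_(k : 'Z_2)
    Ttheta_homog i j k (component i p) (component j q) (component k r).

Lemma Ttheta_bracketE du dv dw (u v w : g) (x y z : M) :
  is_3BihomLie_superalgebra -> is_representation -> trilinear theta ->
  inverses_well_defined ->
  homog du u -> homog du x -> homog dv v -> homog dv y ->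
  homog dw w -> homog dw z ->
  Ttheta_bracket (u, x) (v, y) (w, z) =
  ([u, v, w],
   theta u v w + rho u v z
   - sgn (dv * dw) *: rho u (alphaV (beta w)) (alphaM (betaMV y))
   + sgn (du * (dv + dw)) *: rho v (alphaV (beta w)) (alphaM (betaMV x))).
Proof.
have lin0 (A B : lmodType K) (f : A -> B) : linear f -> f 0 = 0.
  by move=> hf; have := hf (-1) 0 0; rewrite !scaleN1r !addNr.
move=> hg hM [t1 t2 t3] hwd hu hx hv hy hw hz.
have [b1 b2 b3] := bracket_trilinear hg.
have [r1 r2 r3] := rho_trilinear hM.
have alphaVK c : alpha (alphaV c) = c by rewrite /preimage; case: (cid _).
have betaMVK c : betaM (betaMV c) = c by rewrite /preimage; case: (cid _).
have a0 : alpha 0 = 0 by apply: lin0; exact: alpha_linear hg.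
have b0 : beta 0 = 0 by apply: lin0; exact: beta_linear hg.
have am0 : alphaM 0 = 0 by apply: lin0; exact: alphaM_linear hM.
have bm0 : betaM 0 = 0 by apply: lin0; exact: betaM_linear hM.
have bu0 p q : br 0 p q = 0 by apply: (lin0 _ _ (fun u => br u p q)).
have bv0 p q : br p 0 q = 0 by apply: (lin0 _ _ (fun u => br p u q)).
have bw0 p q : br p q 0 = 0 by apply: lin0.
have tu0 p q : theta 0 p q = 0 by apply: (lin0 _ _ (fun u => theta u p q)).
have tv0 p q : theta p 0 q = 0 by apply: (lin0 _ _ (fun u => theta p u q)).
have tw0 p q : theta p q 0 = 0 by apply: lin0.
have ru0 p q : rho 0 p q = 0 by apply: (lin0 _ _ (fun u => rho u p q)).
have rv0 p q : rho p 0 q = 0 by apply: (lin0 _ _ (fun u => rho p u q)).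
have rw0 p q : rho p q 0 = 0 by apply: lin0.
have m0 p c : rho p (alphaV (beta c)) (alphaM (betaMV 0)) = 0.
  have e : betaM (betaMV 0) = betaM 0 by rewrite betaMVK bm0.
  by rewrite (hwd p c _ _ _ _ (alphaVK _) (alphaVK _) e) am0 rw0.
have c0 p m : rho p (alphaV (beta 0)) (alphaM m) = 0.
  have e : alpha 0 = beta 0 by rewrite a0 b0.
  by rewrite (hwd p 0 _ _ m m (alphaVK _) e erefl) rv0.
have off d i (V : superspace K) (a : V) :
    homog d a -> i != d -> component i a = 0.
  by move=> <- /negbTE nid; rewrite component_component nid.
rewrite /Ttheta_bracket (bigD1 du) //= [X in _ + X]big1 ?addr0; last first.
  move=> i ni; rewrite big1 // => j _; rewrite big1 // => k _.
  rewrite /dsum_component /= (off _ _ _ _ hu ni) (off _ _ _ _ hx ni).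
  by rewrite bu0 tu0 !ru0 m0 !scaler0 subr0 !addr0.
rewrite (bigD1 dv) //= [X in _ + X]big1 ?addr0; last first.
  move=> j nj; rewrite big1 // => k _.
  rewrite /dsum_component /= (off _ _ _ _ hv nj) (off _ _ _ _ hy nj).
  by rewrite bv0 tv0 !rv0 !ru0 m0 !scaler0 subr0 !addr0.
rewrite (bigD1 dw) //= [X in _ + X]big1 ?addr0; last first.
  move=> k nk.
  rewrite /dsum_component /= (off _ _ _ _ hw nk) (off _ _ _ _ hz nk).
  by rewrite bw0 tw0 !c0 rw0 !scaler0 subr0 !addr0.
by rewrite /dsum_component /= hu hx hv hy hw hz.
Qed.

End BihomLie.

(* Main.v *)
(** The only preimages that matter are explicit ones: [betaM^-1] is applied to
    [betaM m] or [betaM (betaM m)], and if [x = alpha y], [x' = alpha y'] then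
    [br (beta (beta y)) (beta (beta y')) (beta z)] is a preimage under [alpha] of
    [beta (br (beta x) (beta x') (alpha z))]. In the Jacobi identity for elements
    [(x_i, m_i)], the part without [m_i] is the cocycle condition; the rest is a
    sum of terms linear in a single [m_i], where the terms in [m_3], [m_4], [m_5]
    agree by (R3) and those in [m_1], [m_2] by (R4). *)

Require Import Defs.
From HB Require Import structures.
From mathcomp Require Import all_boot all_order all_algebra.
From mathcomp Require Import boolp.

Set Implicit Arguments.
Unset Strict Implicit.
Unset Printing Implicit Defensive.

Import GRing.Theory.
Local Open Scope ring_scope.

(* Reflexive decision of identities in abelian groups: two sides are equal when
   every atom occurs in them with the same multiplicity [zcoef]. *)
Inductive zexpr := ZVar of nat | ZZero | ZAdd of zexpr & zexpr | ZOpp of zexpr.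

Fixpoint zeval (V : zmodType) (env : seq V) (e : zexpr) : V :=
  match e with
  | ZVar i => env`_i
  | ZZero => 0
  | ZAdd e1 e2 => zeval env e1 + zeval env e2
  | ZOpp e1 => - zeval env e1
  end.

Fixpoint zcoef (e : zexpr) (i : nat) : int :=
  match e with
  | ZVar j => (i == j : nat)%:Z
  | ZZero => 0
  | ZAdd e1 e2 => zcoef e1 i + zcoef e2 i
  | ZOpp e1 => - zcoef e1 i
  end.

Lemma zevalE (V : zmodType) (env : seq V) e :
  zeval env e = \sum_(i < size env) env`_i *~ zcoef e i.
Proof.
elim: e => [j||e1 IH1 e2 IH2|e1 IH1] /=.
- have [ltj|lej] := ltnP j (size env).
    rewrite (bigD1 (Ordinal ltj)) //= eqxx mulr1z big1 ?addr0 // => i.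
    by rewrite -val_eqE /= => /negbTE->; rewrite mulr0z.
  (* An index outside [env] evaluates to the default 0, and its coefficient vanishes at every index
     of the sum. *)
  rewrite nth_default // big1 // => i _.
  by rewrite ltn_eqF ?mulr0z // (leq_trans (ltn_ord i)).
- by rewrite big1 // => i _; rewrite mulr0z.
- by rewrite IH1 IH2 -big_split; apply: eq_bigr => i _; rewrite mulrzDr.
- by rewrite IH1 -sumrN; apply: eq_bigr => i _; rewrite mulrNz.
Qed.

(** The coefficients are closed integers, so for reified expressions the hypothesis is settled by
    computation. *)
Lemma zeval_eq (V : zmodType) (env : seq V) e1 e2 :
  all (fun i => zcoef e1 i == zcoef e2 i) (iota 0 (size env)) ->
  zeval env e1 = zeval env e2.
Proof.
move=> /allP eq12; rewrite !zevalE; apply: eq_bigr => i _.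
by rewrite (eqP (eq12 i _)) // mem_iota add0n ltn_ord.
Qed.

Ltac zmem x env :=
  lazymatch env with
  | nil => constr:(false)
  | x :: _ => constr:(true)
  | _ :: ?env' => zmem x env'
  end.

Ltac zatoms t env :=
  lazymatch t with
  | ?a + ?b => let env1 := zatoms a env in zatoms b env1
  | - ?a => zatoms a env
  | 0 => env
  | _ => lazymatch zmem t env with true => env | false => constr:(t :: env) end
  end.

Ltac zindex x env :=
  lazymatch env with
  | x :: _ => constr:(0%N)
  | _ :: ?env' => let n := zindex x env' in constr:(n.+1)
  end.

Ltac zreify t env :=
  lazymatch t with
  | ?a + ?b =>
      let ea := zreify a env in let eb := zreify b env in constr:(ZAdd ea eb)
  | - ?a => let ea := zreify a env in constr:(ZOpp ea)
  | 0 => constr:(ZZero)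
  | _ => let i := zindex t env in constr:(ZVar i)
  end.

Ltac zmodule :=
  lazymatch goal with
  | |- @eq ?T ?a ?b =>
      let env0 := zatoms a (@nil T) in
      let env := zatoms b env0 in
      let ea := zreify a env in
      let eb := zreify b env in
      exact: (@zeval_eq _ env ea eb (erefl true))
  end.

(** * Signs and degrees in ['Z_2] *)

Lemma sgn0 (K : fieldType) : sgn K 0 = 1.
Proof. by []. Qed.

Lemma sgn1 (K : fieldType) : sgn K 1 = -1.
Proof. by []. Qed.

Lemma Z2P (d : 'Z_2) : d = 0 \/ d = 1.
Proof. by case: d => [[|[|//]] ltd]; [left | right]; apply/val_inj. Qed.

Lemma Z2_1D1 : 1 + 1 = 0 :> 'Z_2.
Proof. exact/val_inj. Qed.

(* Once all degrees are replaced by 0 or 1, this turns every sign into + or -. *)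
Ltac sgn_simpl :=
  rewrite ?(mul0r, mul1r, mulr0, mulr1, add0r, addr0, Z2_1D1) ?(sgn0, sgn1)
    ?(scaleN1r, scale1r, scalerDr, scalerN, opprK).

(** * Linear and even maps between superspaces *)

Section SuperspaceMaps.
Variable K : fieldType.

Lemma linear_fun0 (A B : lmodType K) (f : A -> B) : linear f -> f 0 = 0.
Proof. by move=> fL; have := fL (-1) 0 0; rewrite !scaleN1r !addNr. Qed.

Lemma linear_funD (A B : lmodType K) (f : A -> B) :
  linear f -> {morph f : x y / x + y}.
Proof. by move=> fL x y; rewrite -[x]scale1r fL !scale1r. Qed.

Lemma linear_funZ (A B : lmodType K) (f : A -> B) c :
  linear f -> {morph f : x / c *: x}.
Proof. by move=> fL x; rewrite -[c *: x]addr0 fL linear_fun0 ?addr0. Qed.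

Lemma linear_funN (A B : lmodType K) (f : A -> B) :
  linear f -> {morph f : x / - x}.
Proof. by move=> fL x; rewrite -scaleN1r linear_funZ // scaleN1r. Qed.

Lemma linear_sumf (I : finType) (A B : lmodType K) (f : I -> A -> B) :
  (forall i, linear (f i)) -> linear (fun x => \sum_i f i x).
Proof.
move=> fL a x y; rewrite scaler_sumr -big_split.
by apply: eq_bigr => i _; rewrite fL.
Qed.

Implicit Types V W : superspace K.

Lemma homogD V d (u v : V) : homog d u -> homog d v -> homog d (u + v).
Proof.
by move=> hu hv; rewrite /homog (linear_funD (component_linear d)) hu hv.
Qed.

Lemma homogZ V d c (u : V) : homog d u -> homog d (c *: u).
Proof. by move=> hu; rewrite /homog (linear_funZ _ (component_linear d)) hu. Qed.

Lemma homogN V d (u : V) : homog d u -> homog d (- u).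
Proof. by rewrite -scaleN1r; apply: homogZ. Qed.

Lemma homog_dsum V W d (u : V) (x : W) :
  @homog K (dsum V W) d (u, x) <-> homog d u /\ homog d x.
Proof. by split=> [[]|[hu hx]] //; congr pair. Qed.

(** Split [u] into its two components: [f] keeps each in its degree, so the projection in degree [i]
    retains exactly the image of the [i]-th one. *)
Lemma even1_component V W (f : V -> W) : linear f -> even1 f ->
  forall i u, f (component i u) = component i (f u).
Proof.
move=> fL fE i u; rewrite [in RHS](component_sum u) linear_funD //.
have hE j : component i (f (component j u)) =
    if i == j then f (component j u) else 0.
  have <- : component j (f (component j u)) = f (component j u).
    by apply: fE; rewrite /homog component_component eqxx.
  by rewrite component_component; case: eqP => // <-; rewrite component_component eqxx.
rewrite (linear_funD (component_linear i)) !hE.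
by case: (Z2P i) => ->; rewrite ?addr0 ?add0r.
Qed.

(** An arbitrary preimage may be inhomogeneous, but its component in degree [d] has the same image,
    since [f] commutes with the projections. *)
Lemma homog_preimage V W (f : V -> W) : linear f -> even1 f -> surjective f ->
  forall d v, homog d v -> exists2 u, homog d u & f u = v.
Proof.
move=> fL fE fS d v hv; have [u fu] := fS v.
exists (component d u); first by rewrite /homog component_component eqxx.
by rewrite even1_component // fu.
Qed.

Lemma preimageK V W (f : V -> W) (fS : surjective f) v : f (preimage fS v) = v.
Proof. by rewrite /preimage; case: (cid _). Qed.

End SuperspaceMaps.

(** * The extension of [g] by [M] *)

Section TthetaExtension.
Variables (K : fieldType) (g : superspace K).
Variables (br : g -> g -> g -> g) (alpha beta : g -> g).
Hypothesis hg : is_3BihomLie_superalgebra br alpha beta.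
Variables (M : superspace K) (rho : g -> g -> M -> M) (alphaM betaM : M -> M).
Hypothesis hM : is_representation br alpha beta rho alphaM betaM.
Hypotheses (halpha : surjective alpha) (hbetaM : surjective betaM).
Hypothesis hinv : inverses_well_defined alpha beta rho alphaM betaM.
Variable theta : g -> g -> g -> M.
Hypothesis htheta : is_3cocycle br alpha beta rho alphaM betaM theta.

Local Notation bracket := (Ttheta_bracket br beta rho alphaM theta halpha hbetaM).
Local Notation bracket_homog :=
  (Ttheta_homog br beta rho alphaM theta halpha hbetaM).

Let brL := bracket_trilinear hg.
Let rhoL := rho_trilinear hM.
Let thetaL := theta_trilinear htheta.
Let alphaL := alpha_linear hg.
Let betaL := beta_linear hg.
Let alphaML := alphaM_linear hM.
Let betaML := betaM_linear hM.

(* The paper's rho(u, alpha^-1 beta(w)) (alphaM betaM^-1 (m)). *)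
Definition twisted_rho (u w : g) (m : M) : M :=
  rho u (preimage halpha (beta w)) (alphaM (preimage hbetaM m)).

(** Well-definedness of the inverses allows the chosen preimages to be traded for any convenient
    ones. *)
Lemma twisted_rhoE u w m a m' : alpha a = beta w -> betaM m' = m ->
  twisted_rho u w m = rho u a (alphaM m').
Proof. move=> ea em; rewrite /twisted_rho; apply: (hinv u (preimageK halpha _) ea).
by rewrite preimageK em. Qed.

(** The choice of preimages need not be linear, but a linear combination of preimages is a preimage
    of the linear combination. *)
Lemma twisted_rho_trilinear : trilinear twisted_rho.
Proof.
have [rho1 rho2 rho3] := rhoL.
split=> [w m|u m|u w] c p q; first exact: rho1.
- have [a ea] := halpha (beta p); have [b eb] := halpha (beta q).
  have [n en] := hbetaM m.
  rewrite (twisted_rhoE _ ea en) (twisted_rhoE _ eb en).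
  by rewrite -rho2; apply: twisted_rhoE; rewrite // alphaL betaL ea eb.
- have [a ea] := halpha (beta w).
  have [n en] := hbetaM p; have [n' en'] := hbetaM q.
  rewrite (twisted_rhoE _ ea en) (twisted_rhoE _ ea en').
  by rewrite -rho3 -alphaML; apply: twisted_rhoE; rewrite // betaML en en'.
Qed.

Lemma twisted_rho_even : even3 twisted_rho.
Proof.
move=> i j k u w m hu hw hm.
have [a ha ea] := homog_preimage alphaL (alpha_even hg) halpha (beta_even hg hw).
have [n hn en] := homog_preimage betaML (betaM_even hM) hbetaM hm.
by rewrite (twisted_rhoE _ ea en); apply: (rho_even hM) => //; apply: (alphaM_even hM).
Qed.

(** If [a] and [n] are preimages of [beta w] and [m], then [alpha a] and [alphaM n] are preimages of
    [beta (alpha w)] and [alphaM m]. *)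
Lemma twisted_rho_alpha u w m :
  alphaM (twisted_rho u w m) = twisted_rho (alpha u) (alpha w) (alphaM m).
Proof.
have [a ea] := halpha (beta w); have [n en] := hbetaM m.
rewrite (twisted_rhoE _ ea en) -(rho_alpha hM); apply/esym/twisted_rhoE.
  by rewrite ea (alpha_beta_comm hg).
by rewrite -(alphaM_betaM_comm hM) en.
Qed.

Lemma twisted_rho_beta u w m :
  betaM (twisted_rho u w m) = twisted_rho (beta u) (beta w) (betaM m).
Proof.
have [a ea] := halpha (beta w); have [n en] := hbetaM m.
rewrite (twisted_rhoE _ ea en) -(rho_beta hM) -(alphaM_betaM_comm hM).
by apply/esym/twisted_rhoE; rewrite ?en // (alpha_beta_comm hg) ea.
Qed.

(** * Trilinearity and evenness of the bracket *)

Lemma Ttheta_homogE i j k (p q r : dsum g M) :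
  bracket_homog i j k p q r =
  (br p.1 q.1 r.1,
   theta p.1 q.1 r.1 + rho p.1 q.1 r.2
   - sgn K (j * k) *: twisted_rho p.1 r.1 q.2
   + sgn K (i * (j + k)) *: twisted_rho q.1 r.1 p.2).
Proof. by case: p q r => [u x] [v y] [w z]. Qed.

(** With the degrees as fixed parameters the signs are constants, so linearity holds on
    inhomogeneous elements too. *)
Lemma Ttheta_homog_trilinear i j k : trilinear (bracket_homog i j k).
Proof.
have [b1 b2 b3] := brL; have [r1 r2 r3] := rhoL; have [t1 t2 t3] := thetaL.
have [w1 w2 w3] := twisted_rho_trilinear.
(* Moving [c] in front of the signs makes the atoms on both sides coincide. *)
split=> [q r|p r|p q] c [a x] [b y]; rewrite !Ttheta_homogE; congr pair => /=;
  rewrite ?b1 ?b2 ?b3 // ?r1 ?r2 ?r3 ?t1 ?t2 ?t3 ?w1 ?w2 ?w3 !(scalerDr, scalerN) !scalerA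
   ![sgn K _ * c]mulrC -!scalerA; zmodule.
Qed.

Lemma Ttheta_bracket_trilinear : trilinear bracket.
Proof.
have cL i : linear (@component K (dsum g M) i) by apply: component_linear.
split=> [q r|p r|p q]; apply: linear_sumf => i; apply: linear_sumf => j;
  apply: linear_sumf => k; move=> c p1 p2; rewrite cL;
  by have [h1 h2 h3] := Ttheta_homog_trilinear i j k; rewrite (h1, h2, h3).
Qed.

Lemma Ttheta_bracket_even : even3 bracket.
Proof.
move=> i j k [u x] [v y] [w z] /homog_dsum[hu hx] /homog_dsum[hv hy] /homog_dsum[hw hz].
rewrite (Ttheta_bracketE _ _ hg hM thetaL hinv hu hx hv hy hw hz).
apply/homog_dsum; split; first exact: (bracket_even hg).
rewrite -!/(twisted_rho _ _ _); do 3?apply: homogD.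
- exact: (theta_even htheta).
- exact: (rho_even hM).
(* The arguments of [twisted_rho] come in the orders [u, w, y] and [v, w, x], so the degree sum is
   permuted to match. *)
- by apply/homogN/homogZ; rewrite addrAC; apply: twisted_rho_even.
- by apply/homogZ; rewrite -addrA addrC; apply: twisted_rho_even.
Qed.

(** * Compatibility of the bracket with the structure maps *)

Lemma dsum_map_linear (f : g -> g) (h : M -> M) :
  linear f -> linear h -> linear (dsum_map f h : dsum g M -> dsum g M).
Proof. by move=> fL hL c [u x] [v y]; rewrite /dsum_map /= fL hL. Qed.

Lemma dsum_map_even (f : g -> g) (h : M -> M) :
  even1 f -> even1 h -> even1 (dsum_map f h : dsum g M -> dsum g M).
Proof.
move=> fE hE i [u x] /homog_dsum[hu hx].
by apply/homog_dsum; split; [apply: fE | apply: hE].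
Qed.

(** Serves both [alpha] and [beta]. An even linear map commutes with the projections, so the claim
    reduces to the summands of the bracket. *)
Lemma dsum_map_bracket (f : g -> g) (h : M -> M) :
  linear f -> even1 f -> linear h -> even1 h ->
  (forall u v w, f (br u v w) = br (f u) (f v) (f w)) ->
  (forall u v w, h (theta u v w) = theta (f u) (f v) (f w)) ->
  (forall u v m, h (rho u v m) = rho (f u) (f v) (h m)) ->
  (forall u v m, h (twisted_rho u v m) = twisted_rho (f u) (f v) (h m)) ->
  forall p q r : dsum g M, dsum_map f h (bracket p q r) =
    bracket (dsum_map f h p) (dsum_map f h q) (dsum_map f h r).
Proof.
move=> fL fE hL hE fbr htheta' hrho htw p q r.
have mL := dsum_map_linear fL hL; have mE := dsum_map_even fE hE.
have m_sum (F : 'Z_2 -> dsum g M) :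
    dsum_map f h (\sum_i F i) = \sum_i dsum_map f h (F i).
  exact: (big_morph _ (linear_funD mL) (linear_fun0 mL)).
rewrite /Ttheta_bracket m_sum; apply: eq_bigr => i _.
rewrite m_sum; apply: eq_bigr => j _; rewrite m_sum; apply: eq_bigr => k _.
rewrite -!(even1_component mL mE) !Ttheta_homogE /dsum_map /= fbr.
by rewrite !(linear_funD hL) (linear_funN hL) !(linear_funZ _ hL) htheta' hrho !htw.
Qed.

(** * Inverse-free formulas for the brackets in the identities *)

(** On arguments of the shape required by skew-symmetry the inverses cancel: [beta w] is a preimage
    of [beta (alpha w)], and [x], [y] are preimages of [betaM x], [betaM y]. *)
Lemma Ttheta_bracket_bba i j k u v w x y z :
  homog i u -> homog i x -> homog j v -> homog j y -> homog k w -> homog k z ->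
  bracket (beta u, betaM x) (beta v, betaM y) (alpha w, alphaM z) =
  (br (beta u) (beta v) (alpha w),
   theta (beta u) (beta v) (alpha w) + rho (beta u) (beta v) (alphaM z)
   - sgn K (j * k) *: rho (beta u) (beta w) (alphaM y)
   + sgn K (i * (j + k)) *: rho (beta v) (beta w) (alphaM x)).
Proof.
move=> hu hx hv hy hw hz.
have bE := beta_even hg; have bmE := betaM_even hM.
have aE := alpha_even hg; have amE := alphaM_even hM.
rewrite (Ttheta_bracketE _ _ hg hM thetaL hinv (bE _ _ hu) (bmE _ _ hx)
  (bE _ _ hv) (bmE _ _ hy) (aE _ _ hw) (amE _ _ hz)).
by rewrite -!/(twisted_rho _ _ _) !(twisted_rhoE _ (alpha_beta_comm hg w) erefl).
Qed.

Lemma Ttheta_bracket_nested i1 i2 i3 i4 i5 x1 x2 x3 x4 x5 m1 m2 m3 m4 m5 y3 y4 :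
  homog i1 x1 -> homog i1 m1 -> homog i2 x2 -> homog i2 m2 ->
  homog i3 x3 -> homog i3 m3 -> homog i4 x4 -> homog i4 m4 ->
  homog i5 x5 -> homog i5 m5 -> alpha y3 = x3 -> alpha y4 = x4 ->
  bracket (beta (beta x1), betaM (betaM m1)) (beta (beta x2), betaM (betaM m2))
    (bracket (beta x3, betaM m3) (beta x4, betaM m4) (alpha x5, alphaM m5)) =
  (br (beta (beta x1)) (beta (beta x2)) (br (beta x3) (beta x4) (alpha x5)),
   cocycle_term br alpha beta rho theta x1 x2 x3 x4 x5
   + rho (beta (beta x1)) (beta (beta x2)) (rho (beta x3) (beta x4) (alphaM m5))
   - sgn K (i4 * i5) *:
       rho (beta (beta x1)) (beta (beta x2)) (rho (beta x3) (beta x5) (alphaM m4))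
   + sgn K (i3 * (i4 + i5)) *:
       rho (beta (beta x1)) (beta (beta x2)) (rho (beta x4) (beta x5) (alphaM m3))
   - sgn K (i2 * (i3 + i4 + i5)) *:
       rho (beta (beta x1)) (br (beta (beta y3)) (beta (beta y4)) (beta x5))
         (alphaM (betaM m2))
   + sgn K (i1 * (i2 + (i3 + i4 + i5))) *:
       rho (beta (beta x2)) (br (beta (beta y3)) (beta (beta y4)) (beta x5))
         (alphaM (betaM m1))).
Proof.
move=> hx1 hm1 hx2 hm2 hx3 hm3 hx4 hm4 hx5 hm5 e3 e4.
have bE := beta_even hg; have bmE := betaM_even hM.
have aE := alpha_even hg; have amE := alphaM_even hM.
(* Evenness makes both components of the inner bracket homogeneous of degree [i3 + i4 + i5], as the
   outer formula requires. *)
have := Ttheta_bracket_even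
  (iffRL (homog_dsum _ _ _) (conj (bE _ _ hx3) (bmE _ _ hm3)))
  (iffRL (homog_dsum _ _ _) (conj (bE _ _ hx4) (bmE _ _ hm4)))
  (iffRL (homog_dsum _ _ _) (conj (aE _ _ hx5) (amE _ _ hm5))).
rewrite (Ttheta_bracket_bba hx3 hm3 hx4 hm4 hx5 hm5) => /homog_dsum[hc hn].
rewrite (Ttheta_bracketE _ _ hg hM thetaL hinv (bE _ _ (bE _ _ hx1))
  (bmE _ _ (bmE _ _ hm1)) (bE _ _ (bE _ _ hx2)) (bmE _ _ (bmE _ _ hm2)) hc hn).
(* Only the first two slots call for lifts: the third already holds [alpha x5], and
   [alpha (beta x5) = beta (alpha x5)]. *)
have ec : alpha (br (beta (beta y3)) (beta (beta y4)) (beta x5)) =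
    beta (br (beta x3) (beta x4) (alpha x5)).
  by rewrite (alpha_bracket hg) (beta_bracket hg) !(alpha_beta_comm hg) e3 e4.
rewrite -!/(twisted_rho _ _ _) !(twisted_rhoE _ ec erefl) /cocycle_term.
have [_ _ r3] := rhoL; congr pair.
rewrite !(linear_funD (r3 _ _)) (linear_funN (r3 _ _)) !(linear_funZ _ (r3 _ _)).
by rewrite !addrA.
Qed.

(** This is (R3) at [beta y1], [beta y2], [beta x3], [beta x4] and [alphaM m], with one term flipped
    by skew-symmetry so that the bracket sits in the second slot, as in [Ttheta_bracket_nested]. *)
Lemma rho_R3_alpha i1 i2 i3 i4 x1 x2 x3 x4 y1 y2 m :
  homog i1 y1 -> homog i2 y2 -> homog i3 x3 -> homog i4 x4 ->
  alpha y1 = x1 -> alpha y2 = x2 ->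
  rho (beta (beta x1)) (beta (beta x2)) (rho (beta x3) (beta x4) (alphaM m)) =
    sgn K ((i1 + i2) * (i3 + i4)) *:
      rho (beta (beta x3)) (beta (beta x4)) (rho (beta x1) (beta x2) (alphaM m))
  - sgn K ((i1 + i2 + i3) * i4) *:
      rho (beta (beta x4)) (br (beta (beta y1)) (beta (beta y2)) (beta x3))
        (alphaM (betaM m))
  + sgn K (i3 * (i1 + i2)) *:
      rho (beta (beta x3)) (br (beta (beta y1)) (beta (beta y2)) (beta x4))
        (alphaM (betaM m)).
Proof.
move=> h1 h2 h3 h4 <- <-; have bE := beta_even hg.
have := rho_R3 hM (alphaM m) (bE _ _ h1) (bE _ _ h2) (bE _ _ h3) (bE _ _ h4).
rewrite -!(alpha_beta_comm hg) -!(alphaM_betaM_comm hM) => ->.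
rewrite (rho_skew hM _ (bracket_even hg (bE _ _ (bE _ _ h1)) (bE _ _ (bE _ _ h2))
  (bE _ _ h3)) (bE _ _ (bE _ _ h4))).
by rewrite scaleNr.
Qed.

(** Flipping the left side puts the bracket first, where (R4) applies at [beta y3], [beta y4],
    [beta x5], [beta x]. *)
Lemma rho_R4_alpha i3 i4 i5 i x3 x4 x5 x y3 y4 m :
  homog i3 y3 -> homog i4 y4 -> homog i5 x5 -> homog i x ->
  alpha y3 = x3 -> alpha y4 = x4 ->
  rho (beta (beta x)) (br (beta (beta y3)) (beta (beta y4)) (beta x5))
    (alphaM (betaM m)) =
    sgn K (i * (i4 + i5) + i3 * (i4 + i5)) *:
      rho (beta (beta x4)) (beta (beta x5)) (rho (beta x) (beta x3) (alphaM m))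
  - sgn K (i * (i3 + i5) + i4 * i5) *:
      rho (beta (beta x3)) (beta (beta x5)) (rho (beta x) (beta x4) (alphaM m))
  + sgn K (i * (i3 + i4)) *:
      rho (beta (beta x3)) (beta (beta x4)) (rho (beta x) (beta x5) (alphaM m)).
Proof.
move=> h3 h4 h5 hx <- <-; have bE := beta_even hg; have aE := alpha_even hg.
have b2 d z (hz : homog d z) := bE _ _ (bE _ _ hz).
rewrite (rho_skew hM _ (b2 _ _ hx) (bracket_even hg (b2 _ _ h3) (b2 _ _ h4) (bE _ _ h5))).
rewrite (alphaM_betaM_comm hM).
rewrite (rho_R4 hM (alphaM m) (bE _ _ h3) (bE _ _ h4) (bE _ _ h5) (bE _ _ hx)).
rewrite !(alpha_beta_comm hg).
have [_ _ r3] := rhoL.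
have a3 := aE _ _ h3; have a4 := aE _ _ h4.
(* Skew-symmetry orders the outer indices increasingly and puts [x] first in each inner factor; the
   signs are then compared parity by parity. *)
rewrite (rho_skew hM _ (b2 _ _ h5) (b2 _ _ a3)).
rewrite (rho_skew hM _ (bE _ _ a3) (bE _ _ hx)) (rho_skew hM _ (bE _ _ a4) (bE _ _ hx)).
rewrite (rho_skew hM _ (bE _ _ h5) (bE _ _ hx)).
rewrite !(linear_funZ _ (r3 _ _)).
case: (Z2P i) => ->; case: (Z2P i3) => ->; case: (Z2P i4) => ->; case: (Z2P i5) => ->;
  sgn_simpl; zmodule.
Qed.

(** * Skew-symmetry and the Jacobi identity *)

(** The swap exchanges the terms in [x] and [y]; the term in [z] changes by skew-symmetry of
    [rho]. *)
Lemma Ttheta_bracket_skew12 i j k (p q r : dsum g M) :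
  homog i p -> homog j q -> homog k r ->
  bracket (dsum_map beta betaM p) (dsum_map beta betaM q) (dsum_map alpha alphaM r) =
  - sgn K (i * j) *:
    bracket (dsum_map beta betaM q) (dsum_map beta betaM p) (dsum_map alpha alphaM r).
Proof.
case: p q r => [u x] [v y] [w z].
move=> /homog_dsum[hu hx] /homog_dsum[hv hy] /homog_dsum[hw hz].
rewrite /dsum_map /= (Ttheta_bracket_bba hu hx hv hy hw hz).
rewrite (Ttheta_bracket_bba hv hy hu hx hw hz).
congr pair; first exact: (bracket_skew12 hg hu hv hw).
rewrite /= (theta_skew12 htheta hu hv hw).
rewrite (rho_skew hM _ (beta_even hg hu) (beta_even hg hv)).
rewrite !(scalerDr, scalerN, scaleNr).
case: (Z2P i) => ->; case: (Z2P j) => ->; case: (Z2P k) => ->; sgn_simpl; zmodule.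
Qed.

(** Here the terms in [y] and [z] are exchanged, and the term in [x] uses skew-symmetry of [rho]. *)
Lemma Ttheta_bracket_skew23 i j k (p q r : dsum g M) :
  homog i p -> homog j q -> homog k r ->
  bracket (dsum_map beta betaM p) (dsum_map beta betaM q) (dsum_map alpha alphaM r) =
  - sgn K (j * k) *:
    bracket (dsum_map beta betaM p) (dsum_map beta betaM r) (dsum_map alpha alphaM q).
Proof.
case: p q r => [u x] [v y] [w z].
move=> /homog_dsum[hu hx] /homog_dsum[hv hy] /homog_dsum[hw hz].
rewrite /dsum_map /= (Ttheta_bracket_bba hu hx hv hy hw hz).
rewrite (Ttheta_bracket_bba hu hx hw hz hv hy).
congr pair; first exact: (bracket_skew23 hg hu hv hw).
rewrite /= (theta_skew23 htheta hu hv hw).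
rewrite (rho_skew hM _ (beta_even hg hv) (beta_even hg hw)).
rewrite !(scalerDr, scalerN, scaleNr).
case: (Z2P i) => ->; case: (Z2P j) => ->; case: (Z2P k) => ->; sgn_simpl; zmodule.
Qed.

Lemma Ttheta_bracket_jacobi dx dy dz du dv (x y z u v : dsum g M) :
  homog dx x -> homog dy y -> homog dz z -> homog du u -> homog dv v ->
  let b := dsum_map beta betaM in let a := dsum_map alpha alphaM in
  bracket (b (b x)) (b (b y)) (bracket (b z) (b u) (a v)) =
    sgn K ((du + dv) * (dx + dy + dz)) *:
      bracket (b (b u)) (b (b v)) (bracket (b x) (b y) (a z))
  - sgn K ((dz + dv) * (dx + dy) + du * dv) *:
      bracket (b (b z)) (b (b v)) (bracket (b x) (b y) (a u))
  + sgn K ((dz + du) * (dx + dy)) *: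
      bracket (b (b z)) (b (b u)) (bracket (b x) (b y) (a v)).
Proof.
case: x y z u v => [x1 m1] [x2 m2] [x3 m3] [x4 m4] [x5 m5].
move=> /homog_dsum[h1 k1] /homog_dsum[h2 k2] /homog_dsum[h3 k3].
move=> /homog_dsum[h4 k4] /homog_dsum[h5 k5] b a; rewrite /b /a /dsum_map /=.
(* Lifts are taken for [x1] to [x4], the elements that fill the first two slots of some inner
   bracket. *)
have lift d x : homog d x -> exists2 y, homog d y & alpha y = x.
  exact: (homog_preimage alphaL (alpha_even hg) halpha).
have [y1 l1 e1] := lift _ _ h1; have [y2 l2 e2] := lift _ _ h2.
have [y3 l3 e3] := lift _ _ h3; have [y4 l4 e4] := lift _ _ h4.
rewrite (Ttheta_bracket_nested h1 k1 h2 k2 h3 k3 h4 k4 h5 k5 e3 e4).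
rewrite (Ttheta_bracket_nested h4 k4 h5 k5 h1 k1 h2 k2 h3 k3 e1 e2).
rewrite (Ttheta_bracket_nested h3 k3 h5 k5 h1 k1 h2 k2 h4 k4 e1 e2).
rewrite (Ttheta_bracket_nested h3 k3 h4 k4 h1 k1 h2 k2 h5 k5 e1 e2).
congr pair; first exact: (bracket_jacobi hg h1 h2 h3 h4 h5).
rewrite /= (theta_cocycle htheta h1 h2 h3 h4 h5).
(* Each term of the left side in a single [m_i] is expanded into terms that occur on the right. *)
rewrite (rho_R3_alpha m5 l1 l2 h3 h4 e1 e2) (rho_R3_alpha m4 l1 l2 h3 h5 e1 e2).
rewrite (rho_R3_alpha m3 l1 l2 h4 h5 e1 e2).
rewrite (rho_R4_alpha m2 l3 l4 h5 h1 e3 e4) (rho_R4_alpha m1 l3 l4 h5 h2 e3 e4).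
(* With the vectors abstracted to variables, only the signs depend on the degrees, and each of the
   32 parity cases is an identity in an abelian group. *)
do 3!(set t := cocycle_term _ _ _ _ _ _ _ _ _ _; move: t => ?).
repeat (set t := rho (beta (beta _)) _ _; move: t => ?).
case: (Z2P dx) => ->; case: (Z2P dy) => ->; case: (Z2P dz) => ->;
case: (Z2P du) => ->; case: (Z2P dv) => ->; sgn_simpl; zmodule.
Qed.

End TthetaExtension.

Theorem proposition3p4 (K : fieldType) (g : superspace K)
  (br : g -> g -> g -> g) (alpha beta : g -> g)
  (hg : is_3BihomLie_superalgebra br alpha beta)
  (M : superspace K) (rho : g -> g -> M -> M) (alphaM betaM : M -> M)
  (hM : is_representation br alpha beta rho alphaM betaM)
  (halpha : surjective alpha) (hbetaM : surjective betaM)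
  (hinv : inverses_well_defined alpha beta rho alphaM betaM)
  (theta : g -> g -> g -> M)
  (htheta : is_3cocycle br alpha beta rho alphaM betaM theta) :
  is_3BihomLie_superalgebra
    (Ttheta_bracket br beta rho alphaM theta halpha hbetaM)
    (dsum_map alpha alphaM) (dsum_map beta betaM).
Proof.
split.
- exact: (Ttheta_bracket_trilinear hg hM halpha hbetaM hinv htheta).
- exact: (Ttheta_bracket_even hg hM halpha hbetaM hinv htheta).
- exact: (dsum_map_linear (alpha_linear hg) (alphaM_linear hM)).
- exact: (dsum_map_even (alpha_even hg) (alphaM_even hM)).
- exact: (dsum_map_linear (beta_linear hg) (betaM_linear hM)).
- exact: (dsum_map_even (beta_even hg) (betaM_even hM)).
- by case=> u x; rewrite /dsum_map /= (alpha_beta_comm hg) (alphaM_betaM_comm hM).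
- apply: dsum_map_bracket.
  + exact: (alpha_linear hg).
  + exact: (alpha_even hg).
  + exact: (alphaM_linear hM).
  + exact: (alphaM_even hM).
  + exact: (alpha_bracket hg).
  + exact: (theta_alpha htheta).
  + by move=> u v m; rewrite (rho_alpha hM).
  + exact: (twisted_rho_alpha hg hM halpha hbetaM hinv).
- apply: dsum_map_bracket.
  + exact: (beta_linear hg).
  + exact: (beta_even hg).
  + exact: (betaM_linear hM).
  + exact: (betaM_even hM).
  + exact: (beta_bracket hg).
  + exact: (theta_beta htheta).
  + by move=> u v m; rewrite (rho_beta hM).
  + exact: (twisted_rho_beta hg hM halpha hbetaM hinv).
- exact: (Ttheta_bracket_skew12 hg hM halpha hbetaM hinv htheta).
- exact: (Ttheta_bracket_skew23 hg hM halpha hbetaM hinv htheta).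
- exact: (Ttheta_bracket_jacobi hg hM halpha hbetaM hinv htheta).
Qed.
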